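(* Let $L=(L,\wedge,\vee,{}',0,1,\exists)$ be a monadic ortholattice, let $L^*$ be its set of non-zero elements, and on $L^*$ put $a\perp b$ iff $a\le b'$, and $a\,R\,b$ iff $b\le\exists a$. Then the map $g:L\to\mathcal{B}(L^*,\perp,R)$, $g(a)=\{b\in L^*:b\le a\}$, is the MacNeille completion of the monadic ortholattice $L$, where $\mathcal{B}(L^*,\perp,R)$ carries the orthocomplementation $A\mapsto A^\perp$ and the quantifier $A\mapsto R[A]^{\perp\perp}$.
   Context: An ortholattice is a bounded lattice with an order-inverting complementation $'$ of period two. A monadic ortholattice is an ortholattice with a quantifier $\exists$, i.e. a closure operator (order preserving, $a\le\exists a$, $\exists\exists a=\exists a$) such that the orthocomplement of each closed element is closed. An orthoframe is a set $X$ with an irreflexive symmetric relation $\perp$. For $S\subseteq X$, $S^\perp=\{y\in X:x\perp y\text{ for all }x\in S\}$; $S$ is bi-orthogonally closed if $S=S^{\perp\perp}$. The set $\mathcal{B}(X)$ of bi-orthogonally closed subsets, ordered by inclusion, is a complete ortholattice with orthocomplement $S\mapsto S^\perp$, meets given by intersection, and joins given by the bi-orthogonal of the union. For a binary relation $R$ on $X$ and $A\subseteq X$, $R[A]=\{y\in X:x\,R\,y\text{ for some }x\in A\}$. A monadic orthoframe is $(X,\perp,R)$ with $(X,\perp)$ an orthoframe and $R$ reflexive, transitive, with $R[R[\{x\}]^\perp]\subseteq R[\{x\}]^\perp$ for all $x\in X$; then $\mathcal{B}(X)$ is a monadic ortholattice under the quantifier $\exists A=R[A]^{\perp\perp}$.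 It is known that $(L^*,\perp,R)$ as in the claim is a monadic orthoframe. For a bounded lattice $L$, its MacNeille completion is a pair $(e,\overline L)$ where $\overline L$ is a complete lattice, $e:L\to\overline L$ is a lattice embedding, and each element of $\overline L$ is both a join and a meet of elements of the image of $L$. For a monadic ortholattice $L$, its MacNeille completion is the bounded lattice $\overline L$ with unary operations $$x^{\overline{'}}=\bigwedge\{e(a'):e(a)\le x\},\qquad \overline{\exists}x=\bigvee\{e(\exists a):e(a)\le x\}.$$ *)

(* Defs.v *)
From HB Require Import structures.
From mathcomp Require Import all_boot all_order.
From mathcomp Require Import boolp classical_sets.

Set Implicit Arguments.
Unset Strict Implicit.
Unset Printing Implicit Defensive.

Import Order.TTheory.
Local Open Scope order_scope.
Local Open Scope classical_set_scope.

HB.mixin Record isOrtholattice (d : Order.disp_t) L of Order.TBLattice d L := {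
  ocompl : L -> L;
  ocompl_anti : forall a b : L, a <= b -> ocompl b <= ocompl a;
  ocomplK : involutive ocompl;
  meet_ocompl : forall a : L, (a `&` ocompl a)%O = \bot;
  join_ocompl : forall a : L, (a `|` ocompl a)%O = \top
}.

#[short(type="ortholatticeType")]
HB.structure Definition Ortholattice (d : Order.disp_t) :=
  {L of isOrtholattice d L & Order.TBLattice d L}.

HB.mixin Record isMonadic (d : Order.disp_t) L of Ortholattice d L := {
  quant : L -> L;
  quant_homo : forall a b : L, a <= b -> quant a <= quant b;
  le_quant : forall a : L, a <= quant a;
  quant_idem : forall a : L, quant (quant a) = quant a;
  quant_ocompl : forall a : L, quant a = a -> quant (ocompl a) = ocompl a
}.

#[short(type="monadicOrtholatticeType")]
HB.structure Definition MonadicOrtholattice (d : Order.disp_t) :=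
  {L of isMonadic d L & Ortholattice d L}.

HB.mixin Record isOrthoframe (X : Type) := {
  perp : X -> X -> Prop;
  perp_irrefl : forall x, ~ perp x x;
  perp_sym : forall x y, perp x y -> perp y x
}.

#[short(type="orthoframeType")]
HB.structure Definition Orthoframe := {X of isOrthoframe X}.

Definition perpset (X : orthoframeType) (S : set X) : set X :=
  [set y | forall x, S x -> perp x y].

Definition relimg (X : Type) (R : X -> X -> Prop) (A : set X) : set X :=
  [set y | exists2 x, A x & R x y].

HB.mixin Record isMonadicFrame X of Orthoframe X := {
  frel : X -> X -> Prop;
  frel_refl : forall x, frel x x;
  frel_trans : forall x y z, frel x y -> frel y z -> frel x z;
  frel_perp : forall x : X,
    relimg frel (perpset (relimg frel [set x])) `<=`
    perpset (relimg frel [set x])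
}.

#[short(type="monadicOrthoframeType")]
HB.structure Definition MonadicOrthoframe :=
  {X of isMonadicFrame X & Orthoframe X}.

Section BiClosed.
Variable X : orthoframeType.
Implicit Types S T : set X.

Lemma perpset_anti S T : S `<=` T -> perpset T `<=` perpset S.
Proof. by move=> ST y Ty x /ST; apply: Ty. Qed.

Lemma sub_perpset2 S : S `<=` perpset (perpset S).
Proof. by move=> y Sy x hx; apply/perp_sym/hx. Qed.

Lemma perpset3 S : perpset (perpset (perpset S)) = perpset S.
Proof.
apply/seteqP; split; last exact: sub_perpset2.
exact/perpset_anti/sub_perpset2.
Qed.

Definition biclosed S : Prop := S = perpset (perpset S).

Lemma biclosed_perpset S : biclosed (perpset S).
Proof. by rewrite /biclosed perpset3. Qed.

Lemma perpset2_min S T : biclosed T -> S `<=` T -> perpset (perpset S) `<=` T.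
Proof. by move=> cT ST; rewrite cT; apply: perpset_anti; exact: perpset_anti. Qed.

Record biset := BiSet_ { biset_val :> set X ; _ : `[< biclosed biset_val >] }.

HB.instance Definition _ := [isSub for biset_val].
HB.instance Definition _ := [Choice of biset by <:].
HB.instance Definition _ := [SubChoice_isSubPOrder of biset by <: with set_display].

Definition BiSet S (cS : biclosed S) : biset := BiSet_ (asboolT cS).

Implicit Types A B C : biset.

Lemma bisetP A : biclosed A.
Proof. by case: A => S /= /asboolP. Qed.

Lemma biset_le A B : (A <= B) = `[< (A : set X) `<=` (B : set X) >].
Proof. by []. Qed.

Lemma biset_inj A B : (A : set X) = B -> A = B.
Proof. exact: val_inj. Qed.

Lemma biclosedI A B : biclosed ((A : set X) `&` (B : set X)).
Proof.
apply/seteqP; split; first exact: sub_perpset2.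
rewrite subsetI; split.
- by apply: perpset2_min; [exact: bisetP|exact: subIsetl].
- by apply: perpset2_min; [exact: bisetP|exact: subIsetr].
Qed.

Definition bimeet A B : biset := BiSet (biclosedI A B).

Definition bijoin A B : biset :=
  BiSet (biclosed_perpset (perpset ((A : set X) `|` (B : set X)))).

Lemma bimeetP A B C : (A <= bimeet B C) = (A <= B) && (A <= C).
Proof. by rewrite !biset_le /= -asbool_and; apply: asbool_equiv_eq; rewrite subsetI. Qed.

Lemma bijoinP A B C : (bijoin A B <= C) = (A <= C) && (B <= C).
Proof.
rewrite !biset_le /= -asbool_and; apply: asbool_equiv_eq; rewrite -subUset.
split=> [h|]; first exact: subset_trans (@sub_perpset2 _) h.
by apply: perpset2_min; exact: bisetP.
Qed.

HB.instance Definition _ :=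
  Order.POrder_MeetJoin_isLattice.Build set_display biset bimeetP bijoinP.

Lemma biclosed0 : biclosed (set0 : set X).
Proof.
apply/seteqP; split=> // y /(_ y) h; exfalso.
by apply: (@perp_irrefl X y); apply: h => x [].
Qed.

Lemma biclosedT : biclosed (setT : set X).
Proof. by apply/seteqP; split=> //; exact: sub_perpset2. Qed.

Definition biset0 : biset := BiSet biclosed0.
Definition bisetT : biset := BiSet biclosedT.

Lemma biset0_le A : biset0 <= A.
Proof. by rewrite biset_le; apply/asboolP. Qed.

Lemma le_bisetT A : A <= bisetT.
Proof. by rewrite biset_le; apply/asboolP. Qed.

HB.instance Definition _ := Order.hasBottom.Build set_display biset biset0_le.
HB.instance Definition _ := Order.hasTop.Build set_display biset le_bisetT.

Definition biperp A : biset := BiSet (biclosed_perpset A).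

Lemma biperp_anti A B : A <= B -> biperp B <= biperp A.
Proof. by rewrite !biset_le => /asboolP AB; apply/asboolP/perpset_anti. Qed.

Lemma biperpK : involutive biperp.
Proof. by move=> A; apply: biset_inj; rewrite /= -bisetP. Qed.

Lemma meet_biperp A : (A `&` biperp A)%O = \bot.
Proof.
apply: biset_inj; apply/seteqP; split=> //= x [Ax /(_ x Ax)].
exact: perp_irrefl.
Qed.

Lemma join_biperp A : (A `|` biperp A)%O = \top.
Proof.
rewrite -[LHS]biperpK; apply: biset_inj.
rewrite /= perpset3; apply/seteqP; split=> // x _ y hy.
exfalso; apply: (@perp_irrefl X y); apply: (hy y); right => z Az.
by apply: hy; left.
Qed.

HB.instance Definition _ := isOrtholattice.Build set_display biset
  biperp_anti biperpK meet_biperp join_biperp.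

End BiClosed.

Section MonadicBiClosed.
Variable X : monadicOrthoframeType.
Implicit Types (S : set X) (A B : biset X).

Definition biquant A : biset X :=
  BiSet (biclosed_perpset (perpset (relimg (@frel X) A))).

Lemma relimg_perpset S :
  relimg (@frel X) (perpset (relimg (@frel X) S)) `<=`
  perpset (relimg (@frel X) S).
Proof.
move=> z [y hy yz] w [x Sx xw].
apply: (@frel_perp X x); last by exists x.
by exists y => // v [_ -> xv]; apply: hy; exists x.
Qed.

Lemma relimg_perpset2 S :
  relimg (@frel X) (perpset (perpset (relimg (@frel X) S))) `<=`
  perpset (perpset (relimg (@frel X) S)).
Proof.
move=> z [y hy yz] w hw.
apply: (@frel_perp X w); last by exists w => //; exact: frel_refl.
by exists y => // v [_ -> wv]; apply/hy/relimg_perpset; exists w.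
Qed.

Lemma sub_relimg S : S `<=` relimg (@frel X) S.
Proof. by move=> x Sx; exists x => //; exact: frel_refl. Qed.

Lemma biquant_homo A B : A <= B -> biquant A <= biquant B.
Proof.
rewrite !biset_le => /asboolP AB; apply/asboolP; do 2 apply: perpset_anti.
by move=> y [x /AB Bx xy]; exists x.
Qed.

Lemma le_biquant A : A <= biquant A.
Proof.
by rewrite biset_le; apply/asboolP => x Ax; exact/sub_perpset2/sub_relimg.
Qed.

Lemma biquant_idem A : biquant (biquant A) = biquant A.
Proof.
apply/eqP; rewrite eq_le le_biquant andbT biset_le; apply/asboolP.
by apply: perpset2_min; [exact: bisetP|exact: relimg_perpset2].
Qed.

Lemma biquant_biperp A : biquant A = A -> biquant (biperp A) = biperp A.
Proof.
move=> cA; apply/eqP; rewrite eq_le le_biquant andbT biset_le; apply/asboolP.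
apply: perpset2_min; first exact: bisetP.
by rewrite -cA /= perpset3; exact: relimg_perpset.
Qed.

HB.instance Definition _ := isMonadic.Build set_display (biset X)
  biquant_homo le_biquant biquant_idem biquant_biperp.

End MonadicBiClosed.

Section NonZero.
Context {d : Order.disp_t} (L : monadicOrtholatticeType d).

Definition nonzero : Type := {a : L | a != \bot}.
Implicit Types (a b c : L) (x y z : nonzero).

Definition nz_perp x y : Prop := val x <= ocompl (val y).

Definition nz_rel x y : Prop := val y <= quant (val x).

Lemma nz_perp_irrefl x : ~ nz_perp x x.
Proof.
move=> h; case/negP: (valP x).
have : val x <= (val x `&` ocompl (val x))%O by rewrite lexI lexx.
by rewrite meet_ocompl lex0.
Qed.

Lemma le_ocomplC a b : a <= ocompl b -> b <= ocompl a.
Proof. by move/ocompl_anti; rewrite ocomplK. Qed.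

Lemma nz_perp_sym x y : nz_perp x y -> nz_perp y x.
Proof. exact: le_ocomplC. Qed.

HB.instance Definition _ :=
  isOrthoframe.Build nonzero nz_perp_irrefl nz_perp_sym.

Definition principal_set a : set nonzero := [set b | val b <= a].

Lemma perpset_principal a :
  perpset (principal_set a) = principal_set (ocompl a).
Proof.
apply/seteqP; split=> [y hy|y ya x xa] /=; last first.
  exact/le_ocomplC/(le_trans ya)/ocompl_anti.
have [->|a0] := eqVneq a \bot.
  by rewrite /principal_set /= -[ocompl _]join0x join_ocompl lex1.
exact/le_ocomplC/(hy (exist _ a a0))/lexx.
Qed.

Lemma biclosed_principal a : biclosed (principal_set a).
Proof. by rewrite /biclosed !perpset_principal ocomplK. Qed.

Lemma nz_rel_refl x : nz_rel x x.
Proof. exact: le_quant. Qed.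

Lemma nz_rel_trans x y z : nz_rel x y -> nz_rel y z -> nz_rel x z.
Proof.
by move=> xy yz; apply: (le_trans yz); rewrite -[leRHS]quant_idem quant_homo.
Qed.

Lemma nz_rel_perp x :
  relimg nz_rel (perpset (relimg nz_rel [set x])) `<=`
  perpset (relimg nz_rel [set x]).
Proof.
have -> : relimg nz_rel [set x] = principal_set (quant (val x)).
  by apply/seteqP; split=> [y [_ ->]|y xy]; last exists x.
rewrite perpset_principal => z [y yx yz].
by apply: (le_trans yz); rewrite -[leRHS]quant_ocompl ?quant_idem ?quant_homo.
Qed.

HB.instance Definition _ :=
  isMonadicFrame.Build nonzero nz_rel_refl nz_rel_trans nz_rel_perp.

Definition principal a : biset nonzero := BiSet (biclosed_principal a).

End NonZero.

Arguments principal {d L} a.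

Definition complete_lattice (d : Order.disp_t) (M : tbLatticeType d) : Prop :=
  forall S : set M, supremums S !=set0 /\ infimums S !=set0.

Definition lattice_embedding (d d' : Order.disp_t)
    (L : tbLatticeType d) (M : tbLatticeType d') (e : L -> M) : Prop :=
  [/\ injective e, {morph e : a b / (a `&` b)%O} & {morph e : a b / (a `|` b)%O}].

Record macneille_completion (d d' : Order.disp_t)
    (L : tbLatticeType d) (M : tbLatticeType d') (e : L -> M) : Prop := {
  macneille_complete : complete_lattice M;
  macneille_embedding : lattice_embedding e;
  macneille_join : forall x : M, exists S : set L, supremums (e @` S) x;
  macneille_meet : forall x : M, exists S : set L, infimums (e @` S) x
}.

(* [neg] and [ex] are arbitrary operations on M, determined by the last two
   fields: infima and suprema in M are unique. *)
Record monadic_macneille_completion (d d' : Order.disp_t)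
    (L : monadicOrtholatticeType d)
    (M : tbLatticeType d') (neg ex : M -> M) (e : L -> M) : Prop := {
  monadic_macneille_lattice : macneille_completion e;
  monadic_macneille_neg : forall x : M,
    infimums [set e (ocompl a) | a in [set a : L | e a <= x]] (neg x);
  monadic_macneille_ex : forall x : M,
    supremums [set e (quant a) | a in [set a : L | e a <= x]] (ex x)
}.

(* Main.v *)
Require Import Defs.
From mathcomp Require Import all_boot all_order.
From mathcomp Require Import boolp classical_sets.

(** The elements of [biset (nonzero L)] are down-closed sets of non-zero
    elements of [L], so each of them is the union, hence the join, of the
    principal sets below it ([supremums_principal]).  Orthocomplementation turns
    this into a statement about meets: [A^perp] consists of the elements
    orthogonal to every member of [A], and the elements orthogonal to [a] form
    [principal (ocompl a)], so [A^perp] is the meet of the sets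
    [principal (ocompl a)] with [principal a] below [A] ([infimums_biperp]).
    Applied to [A^perp] in place of [A], the same formula exhibits [A] itself as
    a meet of principal sets; and as it stands it is the formula that defines
    the orthocomplementation of the MacNeille completion.

    For the quantifier, [R[principal a]] is already the biclosed set
    [principal (quant a)].  Hence [principal] commutes with the quantifiers
    ([biquant_principal]), and [R[A]] is the union of the sets
    [principal (quant a)] with [a] in [A].  Its biclosure, the quantifier of
    [A], is therefore the join of these sets ([supremums_biquant]). *)

Set Implicit Arguments.
Unset Strict Implicit.
Unset Printing Implicit Defensive.

Import Order.TTheory.
Local Open Scope order_scope.
Local Open Scope classical_set_scope.

Lemma ocomplU (d : Order.disp_t) (L : ortholatticeType d) (a b : L) :
  ocompl (a `|` b)%O = (ocompl a `&` ocompl b)%O.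
Proof.
apply/eqP; rewrite eq_le lexI !ocompl_anti ?leUl ?leUr //=.
rewrite -[leLHS]ocomplK; apply: ocompl_anti.
have leC c : (ocompl a `&` ocompl b)%O <= ocompl c ->
    c <= ocompl (ocompl a `&` ocompl b)%O.
  by move/ocompl_anti; rewrite ocomplK.
by rewrite leUx !leC ?leIl ?leIr.
Qed.

(** Forced by the closedness of complements, since [\bot] is the complement of
    the closed element [\top]. *)
Lemma quant0 (d : Order.disp_t) (L : monadicOrtholatticeType d) :
  quant \bot = \bot :> L.
Proof.
have top' : ocompl \top = \bot :> L by rewrite -[LHS]meet1x meet_ocompl.
rewrite -top' quant_ocompl //.
by apply/eqP; rewrite -le1x le_quant.
Qed.

Section Biset.
Variable X : orthoframeType.
Implicit Types (A B : biset X).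

Lemma biset_leP A B : reflect ((A : set X) `<=` (B : set X)) (A <= B).
Proof. by rewrite biset_le; apply: asboolP. Qed.

(** The join of a family is the biclosure of its union; its meet is computed as
    the complement of the join of the complements. *)
Lemma biset_complete : complete_lattice (biset X).
Proof.
have sup (S : set (biset X)) : supremums S !=set0.
  pose U := [set x | exists2 A, S A & (A : set X) x].
  exists (BiSet (biclosed_perpset (perpset U))); split=> [A SA|B ubB].
    by apply/biset_leP => x Ax; apply: sub_perpset2; exists A.
  apply/biset_leP; apply: perpset2_min; first exact: bisetP.
  by move=> x [A SA]; apply/biset_leP/ubB.
move=> S; split; first exact: sup.
have [M [ubM lubM]] := sup [set biperp A | A in S].
exists (biperp M); split=> [A SA|B lbB].
  by rewrite -[leRHS]biperpK; apply/biperp_anti/ubM; exists A.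
rewrite -[leLHS]biperpK; apply/biperp_anti/lubM => _ [A SA <-].
exact/biperp_anti/lbB.
Qed.

End Biset.

Section Principal.
Context {d : Order.disp_t} (L : monadicOrtholatticeType d).
Implicit Types (a b : L) (x y : nonzero L) (A B : biset (nonzero L)).

Lemma perpE x y : perp x y = (val x <= ocompl (val y)) :> Prop.
Proof. by []. Qed.

(** Passing to a smaller element only enlarges what it is orthogonal to. *)
Lemma biset_down A x y : (A : set _) x -> val y <= val x -> (A : set _) y.
Proof.
rewrite (bisetP A) => Ax yx z Az.
by move/(_ z Az): Ax; rewrite !perpE => /le_trans; apply; exact: ocompl_anti.
Qed.

(** The points of [A] are among the indices of the suprema and infima over
    the [a] with [principal a <= A], so a bound of such a family can be tested
    at each point of [A]. *)
Lemma principal_le_biset x A : (principal (val x) <= A) <-> (A : set _) x.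
Proof.
split=> [/biset_leP|Ax]; first by apply; exact: lexx.
by apply/biset_leP => y; exact: biset_down.
Qed.

Lemma le_principal a b : (principal a <= principal b) = (a <= b).
Proof.
apply/idP/idP => [|ab]; last by apply/biset_leP => x /le_trans; apply.
have [->|a0] := eqVneq a \bot; first by rewrite le0x.
exact: (principal_le_biset (exist _ a a0) (principal b)).1.
Qed.

Lemma principal_inj : injective (@principal d L).
Proof. by move=> a b ab; apply/le_anti; rewrite -!le_principal ab lexx. Qed.

Lemma principalC a : principal (ocompl a) = ocompl (principal a).
Proof. exact/biset_inj/esym/perpset_principal. Qed.

Lemma principalI : {morph @principal d L : a b / (a `&` b)%O}.
Proof.
move=> a b; apply: biset_inj; apply/seteqP.
by split=> x /=; rewrite /principal_set /= lexI => /andP.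
Qed.

(** Joins of biclosed sets are not unions, so this follows from [principalI] by
    De Morgan's law on both sides. *)
Lemma principalU : {morph @principal d L : a b / (a `|` b)%O}.
Proof.
move=> a b; apply: (can_inj ocomplK).
by rewrite ocomplU -!principalC -principalI ocomplU.
Qed.

Lemma biquant_principal a : biquant (principal a) = principal (quant a).
Proof.
apply: biset_inj; rewrite /= [RHS]biclosed_principal.
congr (perpset (perpset _)); apply/seteqP; split=> [y [x xa xy]|y ya].
  exact/(le_trans xy)/quant_homo.
(* [a] itself is a witness only if it is a point of the frame. *)
have [a0|a0] := eqVneq a \bot; last by exists (exist _ a a0) => //; exact: lexx.
by move: ya (valP y); rewrite a0 /principal_set /= quant0 lex0 => ->.
Qed.

Lemma supremums_principal A :
  supremums [set principal a | a in [set a : L | principal a <= A]] A.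
Proof.
split=> [_ [a aA <-]//|B ubB].
apply/biset_leP => x /principal_le_biset xA.
by apply/principal_le_biset/ubB; exists (val x).
Qed.

Lemma infimums_biperp A :
  infimums [set principal (ocompl a) | a in [set a : L | principal a <= A]]
    (biperp A).
Proof.
split=> [_ [a aA <-]|B lbB]; first by rewrite principalC; exact: biperp_anti.
apply/biset_leP => y By x /principal_le_biset xA.
suff /biset_leP/(_ y By) yx : B <= principal (ocompl (val x)).
  exact: nz_perp_sym.
by apply: lbB; exists (val x).
Qed.

Lemma supremums_biquant A :
  supremums [set principal (quant a) | a in [set a : L | principal a <= A]]
    (biquant A).
Proof.
split=> [_ [a aA <-]|B ubB].
  by rewrite -biquant_principal; exact: biquant_homo.
apply/biset_leP; apply: perpset2_min; first exact: bisetP.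
move=> y [x /principal_le_biset xA xy].
suff /biset_leP/(_ y xy) : principal (quant (val x)) <= B by [].
by apply: ubB; exists (val x).
Qed.

(** Meet-density is [infimums_biperp] read at [biperp A], whose complement is
    [A]. *)
Lemma macneille_principal : macneille_completion (@principal d L).
Proof.
split; first exact: biset_complete.
- by split; [exact: principal_inj|exact: principalI|exact: principalU].
- by move=> A; eexists; exact: supremums_principal.
- move=> A; exists [set ocompl a | a in [set a | principal a <= biperp A]].
  by rewrite image_comp -[X in infimums _ X]biperpK; exact: infimums_biperp.
Qed.

End Principal.

Theorem proposition3p1 (d : Order.disp_t) (L : monadicOrtholatticeType d) :
  monadic_macneille_completion (M := biset (nonzero L))
    (@biperp (nonzero L)) (@biquant (nonzero L)) (@principal d L).
Proof.
split; first exact: macneille_principal.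
- exact: infimums_biperp.
- exact: supremums_biquant.
Qed.
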